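(* Let $\mathcal{GO}=\langle t,\prec,\phi\rangle$ be a GOMT problem with $\phi$ satisfiable. Suppose $\mathcal{GO}$ has one or more optimal solutions and is not unbounded along any branch. Then every derivation generated by a progressive hybrid strategy, i.e., a progressive strategy for the calculus in which the call $\textsc{Solve}(\phi\wedge\psi)$ in the rule F-Sat is replaced by a call $\textsc{Optimize}(\phi\wedge\psi, t)$, ends with a saturated state whose interpretation component is an optimal solution of $\mathcal{GO}$.
   Context: Fix a many-sorted first-order theory $\mathcal{T}$ (a signature $\Sigma$ together with a class of $\Sigma$-interpretations, the $\mathcal{T}$-interpretations) with equality, and an infinite set of sorted variables; all interpretations considered are $\mathcal{T}$-interpretations assigning a value to every variable, and $\models$ means $\models_{\mathcal{T}}$. A GOMT problem is a triple $\mathcal{GO}=\langle t,\prec,\phi\rangle$ where $t$ is a $\Sigma$-term of some sort $\sigma$, $\prec$ is a strict partial order on the values of sort $\sigma$ definable in $\mathcal{T}$, and $\phi$ is a $\Sigma$-formula. $\mathcal{I}$ is $\mathcal{GO}$-consistent if $\mathcal{I}\models\phi$; $\mathcal{I}<_{\mathcal{GO}}\mathcal{I}'$ if both are $\mathcal{GO}$-consistent and $t^{\mathcal{I}}\prec t^{\mathcal{I}'}$; $\mathcal{I}$ is an optimal solution if it is $\mathcal{GO}$-consistent and no interpretation $\mathcal{J}$ satisfies $\mathcal{J}<_{\mathcal{GO}}\mathcal{I}$. $\textsc{Solve}$ maps a formula to an interpretation satisfying it if it is satisfiable, and to $\bot$ otherwise. $\textsc{Optimize}(\chi,t)$, for a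 formula $\chi$ (here of the form $\phi\wedge\psi$), returns an interpretation $\mathcal{I}'\models\chi$ such that no interpretation $\mathcal{J}\models\chi$ has $t^{\mathcal{J}}\prec t^{\mathcal{I}'}$ (an optimal solution within the branch $\chi$), and $\bot$ if $\chi$ is unsatisfiable. ''Not unbounded along any branch'' means that whenever the calculus calls $\textsc{Optimize}$ on a satisfiable branch $\phi\wedge\psi$, such an optimal solution within that branch exists. $\textsc{Better}$ maps each $\mathcal{GO}$-consistent $\mathcal{I}$ to a formula such that for every $\mathcal{GO}$-consistent $\mathcal{I}'$: $\mathcal{I}'\models\textsc{Better}(\mathcal{I})$ iff $\mathcal{I}'<_{\mathcal{GO}}\mathcal{I}$. For a finite sequence $S=(s_1,\dots,s_n)$, $\textsc{Top}(S)=s_1$, $\textsc{Pop}(S)=(s_2,\dots,s_n)$, $\emptyset$ is the empty sequence, $\circ$ is concatenation. A state is $\langle\mathcal{I},\Delta,\tau\rangle$ ($\mathcal{I}$ an interpretation, $\Delta$ a formula, $\tau$ a finite sequence of formulas). Initial state: $\mathcal{I}_0=\textsc{Solve}(\phi)$, $\Delta_0=\textsc{Better}(\mathcal{I}_0)$, $\tau_0=(\Delta_0)$. Rules (unmentioned components unchanged): F-Split: if $\tau\neq\emptyset$, $\psi=\textsc{Top}(\tau)$, $\phi\models\psi\Leftrightarrow\bigvee_{j=1}^k\psi_j$ with $k\ge1$, then $\tau:=(\psi_1,\dots,\psi_k)\circ\textsc{Pop}(\tau)$. F-Sat: if $\tau\neq\emptyset$, $\psi=\textsc{Top}(\tau)$,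 $\textsc{Solve}(\phi\wedge\psi)=\mathcal{I}'\neq\bot$, $\Delta'=\Delta\wedge\textsc{Better}(\mathcal{I}')$, then $\mathcal{I}:=\mathcal{I}'$, $\Delta:=\Delta'$, $\tau:=(\Delta')$. F-Close: if $\tau\neq\emptyset$, $\psi=\textsc{Top}(\tau)$, $\textsc{Solve}(\phi\wedge\psi)=\bot$, then $\Delta:=\Delta\wedge\neg\psi$, $\tau:=\textsc{Pop}(\tau)$. A rule applies if its premises hold and the resulting state differs; a state is saturated if no rule applies. A derivation is a sequence of states starting at the initial state, each obtained from the previous by one rule. A derivation strategy is progressive if it (i) never halts in a non-saturated state and (ii) uses F-Split only finitely many times in any derivation. *)

(* Defs.v *)
From mathcomp Require Import all_boot.
From mathcomp Require Import boolp classical_sets cardinality.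

Set Implicit Arguments.
Unset Strict Implicit.
Unset Printing Implicit Defensive.

Local Open Scope classical_set_scope.

Record signature := Signature {
  sigsort : Type;
  fsym : Type;
  farity : fsym -> nat;
  fdom : forall f : fsym, 'I_(farity f) -> sigsort;
  fcod : fsym -> sigsort;
  psym : Type;
  parity : psym -> nat;
  pdom : forall p : psym, 'I_(parity p) -> sigsort
}.
Arguments fdom {s} f _.
Arguments pdom {s} p _.

(* [X s] is the type of the variables of sort [s]. *)
Section Syntax.
Context (Sg : signature) (X : sigsort Sg -> Type).

Inductive term : sigsort Sg -> Type :=
| TVar (s : sigsort Sg) (x : X s) : term s
| TApp (f : fsym Sg) (args : forall i, term (fdom f i)) : term (fcod f).

Inductive formula : Type :=
| FEq (s : sigsort Sg) (u v : term s)
| FPred (p : psym Sg) (args : forall i, term (pdom p i))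
| FNot (a : formula)
| FAnd (a b : formula)
| FOr (a b : formula)
| FIff (a b : formula)
| FForall (s : sigsort Sg) (x : X s) (a : formula)
| FExists (s : sigsort Sg) (x : X s) (a : formula).

(* [FDisj a [:: b; c]] is [a \/ (b \/ c)]: only nonempty disjunctions are
   formed, so no formula for falsity is needed. *)
Fixpoint FDisj (a : formula) (l : seq formula) : formula :=
  if l is b :: l' then FOr a (FDisj b l') else a.

Fixpoint occurs (s : sigsort Sg) (x : X s) (s' : sigsort Sg) (u : term s') : Prop :=
  match u with
  | TVar s1 y => existT X s1 y = existT X s x
  | TApp f args => exists i, occurs x (args i)
  end.

Fixpoint free (s : sigsort Sg) (x : X s) (a : formula) : Prop :=
  match a with
  | FEq _ u v => occurs x u \/ occurs x v
  | FPred p args => exists i, occurs x (args i)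
  | FNot b => free x b
  | FAnd b c | FOr b c | FIff b c => free x b \/ free x c
  | FForall s1 y b | FExists s1 y b =>
      existT X s1 y <> existT X s x /\ free x b
  end.

End Syntax.

(* Values of different interpretations have to be compared by a single order,
   so the domains of all interpretations are taken to be subsets of a common
   universe [V s] for each sort [s]. *)
Record structure (Sg : signature) (V : sigsort Sg -> Type) := Structure {
  dom : forall s : sigsort Sg, set (V s);
  dom_nonempty : forall s, @dom s !=set0;
  fint : forall f : fsym Sg,
    (forall i, set_type (@dom (fdom f i))) -> set_type (@dom (fcod f));
  pint : forall p : psym Sg,
    (forall i, set_type (@dom (pdom p i))) -> Prop
}.
Arguments dom {Sg V} M s _ : rename.
Arguments fint {Sg V} M f _ : rename.
Arguments pint {Sg V} M p _ : rename.

Section Semantics.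
Context (Sg : signature) (X V : sigsort Sg -> Type).

Local Notation structure := (structure V).

Definition assignment (M : structure) :=
  forall s : sigsort Sg, X s -> set_type (dom M s).

Record interpretation := Interpretation {
  str : structure;
  asg : assignment str
}.

Fixpoint eval (M : structure) (r : assignment M) (s : sigsort Sg) (u : term X s) :
    set_type (dom M s) :=
  match u with
  | TVar s x => r s x
  | TApp f args => fint M f (fun i => eval r (args i))
  end.

Definition variant (M : structure) (s : sigsort Sg) (x : X s)
    (r r' : assignment M) : Prop :=
  forall (s' : sigsort Sg) (y : X s'),
    existT X s' y <> existT X s x -> r' s' y = r s' y.

Fixpoint holds (M : structure) (r : assignment M) (a : formula X) : Prop :=
  match a with
  | FEq _ u v => eval r u = eval r v
  | FPred p args => pint M p (fun i => eval r (args i))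
  | FNot b => ~ holds r b
  | FAnd b c => holds r b /\ holds r c
  | FOr b c => holds r b \/ holds r c
  | FIff b c => holds r b <-> holds r c
  | FForall _ x b => forall r', variant x r r' -> holds r' b
  | FExists _ x b => exists2 r', variant x r r' & holds r' b
  end.

Definition theory := set interpretation.

Definition tinterp (T : theory) := {I : interpretation | T I}.

Section Theory.
Context (T : theory).

Definition value (I : tinterp T) (s : sigsort Sg) (u : term X s) : V s :=
  val (eval (@asg (sval I)) u).

Definition sat (I : tinterp T) (a : formula X) : Prop := holds (@asg (sval I)) a.

Definition satisfiable (a : formula X) : Prop := exists I, sat I a.

Definition entails (a b : formula X) : Prop := forall I, sat I a -> sat I b.

Definition tvalues (s : sigsort Sg) : set (V s) :=
  [set a | exists I : tinterp T, dom (str (sval I)) s a].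

(* The relation defined in [T] by a formula [d] whose free variables are [x]
   and [y] is the set of the pairs (x^I, y^I), for [I] a [T]-interpretation
   satisfying [d]. *)
Definition definable2 (s : sigsort Sg) (lt : V s -> V s -> Prop) : Prop :=
  exists (x y : X s) (d : formula X),
    [/\ x <> y,
        forall (s' : sigsort Sg) (z : X s'),
          free z d <-> existT X s' z = existT X s x \/
                       existT X s' z = existT X s y &
        forall a b : V s,
          lt a b <-> exists I : tinterp T,
            [/\ sat I d, value I (TVar x) = a & value I (TVar y) = b] ].

Record gomt := Gomt {
  gsort : sigsort Sg;
  obj : term X gsort;
  prec : V gsort -> V gsort -> Prop;
  constr : formula X;
  prec_irr : forall a, tvalues a -> ~ prec a a;
  prec_trans : forall a b c, tvalues a -> tvalues b -> tvalues c ->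
    prec a b -> prec b c -> prec a c;
  prec_def : definable2 prec
}.

Section GOMT.
Context (GO : gomt).
Let phi := constr GO.
Let t := obj GO.

Definition consistent (I : tinterp T) : Prop := sat I phi.

Definition better_than (I I' : tinterp T) : Prop :=
  [/\ consistent I, consistent I' & prec (value I t) (value I' t)].

Definition optimal (I : tinterp T) : Prop :=
  consistent I /\ ~ exists J, better_than J I.

Definition branch_optimal (chi : formula X) (I : tinterp T) : Prop :=
  sat I chi /\ ~ exists2 J, sat J chi & prec (value J t) (value I t).

(* [None] stands for the answer "unsatisfiable" of the procedures. *)
Definition solve_spec (solve : formula X -> option (tinterp T)) : Prop :=
  forall a : formula X,
    if solve a is Some J then sat J a else ~ satisfiable a.

(* Nothing is required of [optimize] on a satisfiable [chi] that has no
   optimal solution. *)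
Definition optimize_spec
    (optimize : formula X -> term X (gsort GO) -> option (tinterp T)) : Prop :=
  forall chi : formula X,
    ((exists I, branch_optimal chi I) ->
       exists2 I, optimize chi t = Some I & branch_optimal chi I) /\
    (~ satisfiable chi -> optimize chi t = None).

Definition better_spec (better : tinterp T -> formula X) : Prop :=
  forall I, consistent I -> forall I', consistent I' ->
    (sat I' (better I) <-> better_than I' I).

Record state := State {
  cur : tinterp T;
  delta : formula X;
  tau : seq (formula X)
}.

Variant rule := FSplit | FSat | FClose.

Section Calculus.
Context (solve : formula X -> option (tinterp T)).
Context (better : tinterp T -> formula X).

(* The procedure called by F-Sat: [solve] itself in the plain calculus. *)
Context (ask : formula X -> option (tinterp T)).

Definition initial (s : state) : Prop :=
  exists2 I0, solve phi = Some I0 &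
    s = State I0 (better I0) [:: better I0].

Variant step (s : state) : rule -> state -> Prop :=
| StepSplit psi tau' psi1 psis of
    tau s = psi :: tau' &
    entails phi (FIff psi (FDisj psi1 psis)) :
    step s FSplit (State (cur s) (delta s) ((psi1 :: psis) ++ tau'))
| StepSat psi tau' I' of
    tau s = psi :: tau' &
    ask (FAnd phi psi) = Some I' :
    step s FSat (State I' (FAnd (delta s) (better I'))
                          [:: FAnd (delta s) (better I')])
| StepClose psi tau' of
    tau s = psi :: tau' &
    solve (FAnd phi psi) = None :
    step s FClose (State (cur s) (FAnd (delta s) (FNot psi)) tau').

Definition applies (s : state) (r : rule) (s' : state) : Prop :=
  step s r s' /\ s' <> s.

Definition saturated (s : state) : Prop := ~ exists r s', applies s r s'.

(* A finite run: the first state, then each rule used with its result. *)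
Record history := History {
  start : state;
  steps : seq (rule * state)
}.

Definition current (h : history) : state :=
  last (start h) [seq x.2 | x <- steps h].

Definition extend (h : history) (r : rule) (s : state) : history :=
  History (start h) (rcons (steps h) (r, s)).

(* A strategy may be nondeterministic and may depend on the whole run:
   [moves h r s] and [stop h] say which continuations it allows after [h]. *)
Record strategy := Strategy {
  moves : history -> rule -> state -> Prop;
  stop : history -> Prop;
  movesP : forall h r s, moves h r s -> applies (current h) r s
}.

Inductive generated (S : strategy) : history -> Prop :=
| Gen0 s of initial s : generated S (History s [::])
| GenS h r s of generated S h & moves S h r s : generated S (extend h r s).

Definition halts (S : strategy) (h : history) : Prop :=
  stop S h \/ ~ exists r s, moves S h r s.

Variant derivation :=
| FinRun of history
| InfRun of state & nat -> rule * state.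

Definition generates (S : strategy) (d : derivation) : Prop :=
  match d with
  | FinRun h => generated S h /\ halts S h
  | InfRun s u => forall n, generated S (History s (mkseq u n))
  end.

Definition finitely_many_splits (d : derivation) : Prop :=
  match d with
  | FinRun _ => True
  | InfRun _ u => exists N, forall n, N <= n -> (u n).1 <> FSplit
  end.

Definition progressive (S : strategy) : Prop :=
  (forall h, generated S h -> halts S h -> saturated (current h)) /\
  (forall d, generates S d -> finitely_many_splits d).

Definition ends_with (d : derivation) (s : state) : Prop :=
  if d is FinRun h then s = current h else False.

(* The call of [ask] on the branch [psi] takes place when [S] uses F-Sat in a
   state whose top formula is [psi], along some run generated by [S]. *)
Definition calls (S : strategy) (psi : formula X) : Prop :=
  exists h, [/\ generated S h, ohead (tau (current h)) = Some psi &
                exists s, moves S h FSat s].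

Definition not_unbounded (S : strategy) : Prop :=
  forall psi, calls S psi -> satisfiable (FAnd phi psi) ->
    exists I, branch_optimal (FAnd phi psi) I.

End Calculus.

Definition hybrid_strategy
    (solve : formula X -> option (tinterp T))
    (optimize : formula X -> term X (gsort GO) -> option (tinterp T))
    (better : tinterp T -> formula X) :=
  strategy solve better (fun chi => optimize chi t).

End GOMT.
End Theory.
End Semantics.

(* Main.v *)
Require Import Defs.
From mathcomp Require Import all_boot.
From mathcomp Require Import boolp classical_sets cardinality.

Set Implicit Arguments.
Unset Strict Implicit.
Unset Printing Implicit Defensive.

Local Open Scope classical_set_scope.

(** Along every run, a [phi]-model satisfies [Delta] iff it satisfies some member
    of [tau] iff it improves on the current interpretation.  F-Split applies
    whenever [tau] is nonempty (split [psi] into [psi, psi]), so a saturated state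
    has empty [tau] and nothing improves on its interpretation.  An infinite run
    eventually stops splitting.  Since F-Close shortens [tau], some F-Sat occurs
    after that; it leaves the single branch [Delta], which F-Close would empty, so
    F-Sat is used at each of the next two steps.  But the first of these returns an
    optimum [I] of the branch [Delta], and the second an interpretation of the same
    branch that improves on [I]. *)

Section Calculus.
Context (Sg : signature) (X V : sigsort Sg -> Type) (T : theory X V).
Context (GO : gomt T).

Definition sat_some (J : tinterp T) (l : seq (formula X)) : bool :=
  has (fun psi => `[< sat J psi >]) l.

Lemma sat_FDisj (J : tinterp T) (a : formula X) (l : seq (formula X)) :
  sat J (FDisj a l) <-> sat_some J (a :: l).
Proof.
elim: l a => [|b l IHl] a.
  by rewrite /sat_some /= orbF; split=> [?|/asboolP //]; apply/asboolP.
split=> [[Ha|/IHl Hl]|/orP[/asboolP Ha|/IHl Hl]].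
- by apply/orP; left; apply/asboolP.
- by apply/orP; right.
- by left.
- by right.
Qed.

(** Serves to discharge the side conditions of [prec_trans], which holds only on [tvalues]. *)
Lemma tvalues_value (I : tinterp T) (s : sigsort Sg) (u : term X s) :
  tvalues T (value I u).
Proof. by exists I; rewrite /value; apply/set_mem/valP. Qed.

Lemma better_than_trans (I J K : tinterp T) :
  better_than GO I J -> better_than GO J K -> better_than GO I K.
Proof.
move=> [cI _ IJ] [_ cK JK]; split=> //.
by apply: prec_trans IJ JK; apply: tvalues_value.
Qed.

(** Only models of [constr GO] are tested, because [better] and the equivalence in F-Split are
    specified on these alone. *)
Definition state_invariant (s : state T) : Prop :=
  consistent GO (cur s) /\
  forall J, consistent GO J ->
    (sat J (delta s) <-> better_than GO J (cur s)) /\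
    (sat_some J (tau s) <-> better_than GO J (cur s)).

Lemma state_invariant_nil_optimal (s : state T) :
  state_invariant s -> tau s = [::] -> optimal GO (cur s).
Proof.
move=> [cs sP] s0; split=> // -[J Js]; have [cJ _ _] := Js.
by have [_ [_ /(_ Js)]] := sP J cJ; rewrite s0.
Qed.

Context (solve : formula X -> option (tinterp T)).
Context (optimize : formula X -> term X (gsort GO) -> option (tinterp T)).
Context (better : tinterp T -> formula X).
Hypothesis solveP : solve_spec solve.
Hypothesis optimizeP : optimize_spec optimize.
Hypothesis betterP : better_spec GO better.

Let ask (chi : formula X) := optimize chi (obj GO).

Lemma saturated_nil (s : state T) :
  saturated GO solve better ask s -> tau s = [::].
Proof.
case E: (tau s) => [//|psi tau'] sat_s; case: sat_s.
(* A rule applies only if the state changes; the duplicate guarantees this, since [tau] grows by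
   one. *)
exists FSplit, (State (cur s) (delta s) ([:: psi; psi] ++ tau')); split.
  by apply: StepSplit E _ => J _; split=> [|[]] //; left.
move=> /(congr1 (fun s => size (tau s))); rewrite E /= => /eqP.
by rewrite gtn_eqF.
Qed.

Lemma initial_state_invariant (s : state T) :
  initial GO solve better s -> state_invariant s.
Proof.
move=> [I0 solve0 ->].
have c0 : consistent GO I0 by have := solveP (constr GO); rewrite solve0.
split=> //= J cJ; split; first exact: betterP.
by rewrite /sat_some /= orbF -(betterP c0 cJ); split=> [/asboolP|/asboolP].
Qed.

Variable S : hybrid_strategy solve optimize better.
Hypothesis S_bounded : not_unbounded S.

(** An answer [Some] shows that the branch is satisfiable. [S_bounded] then provides an optimum in
    the branch, and only then does [optimizeP] force the answer itself to be optimal. *)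
Lemma moves_FSat (h : history T) (s : state T) :
  generated S h -> moves S h FSat s ->
  exists psi tau' I',
    [/\ tau (current h) = psi :: tau',
        branch_optimal GO (FAnd (constr GO) psi) I' &
        s = State I' (FAnd (delta (current h)) (better I'))
                     [:: FAnd (delta (current h)) (better I')]].
Proof.
move=> gen_h hs; have [st _] := movesP hs.
inversion st as [|psi tau' I' tau_h askE|]; exists psi, tau', I'; split=> //.
have [opt_some opt_none] := optimizeP (FAnd (constr GO) psi).
have [I I_opt] : exists I, branch_optimal GO (FAnd (constr GO) psi) I.
  apply: S_bounded; first by exists h; rewrite tau_h; split=> //; exists s.
  by apply: contrapT => /opt_none; rewrite askE.
have [|I1] := opt_some; first by exists I.
by rewrite askE => -[->].
Qed.

Lemma moves_FClose (h : history T) (s : state T) :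
  moves S h FClose s ->
  exists psi tau',
    [/\ tau (current h) = psi :: tau', ~ satisfiable T (FAnd (constr GO) psi) &
        s = State (cur (current h)) (FAnd (delta (current h)) (FNot psi)) tau'].
Proof.
move=> /movesP[st _]; inversion st as [| |psi tau' tau_h solveE].
exists psi, tau'; split=> //.
by have := solveP (FAnd (constr GO) psi); rewrite solveE.
Qed.

Lemma current_extend (h : history T) (r : rule) (s : state T) :
  current (extend h r s) = s.
Proof. by rewrite /current /= map_rcons last_rcons. Qed.

(** On models of [constr GO], F-Split replaces [psi] by an equivalent disjunction, and F-Close
    discards a [psi] that never holds. F-Sat is the case that needs transitivity of
    [better_than]. *)
Lemma moves_invariant (h : history T) (r : rule) (s : state T) :
  generated S h -> moves S h r s -> state_invariant (current h) ->
  state_invariant s.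
Proof.
move=> gen_h hs [ch hP]; case: r hs => hs.
- have [st _] := movesP hs.
  inversion st as [psi tau' psi1 psis tau_h split_psi| |].
  split=> //= J cJ; have [dJ tJ] := hP J cJ; split=> //.
  have psiE : sat_some J (psi1 :: psis) = `[< sat J psi >].
    apply/idP/asboolP => [/sat_FDisj|] /(split_psi J cJ) //.
    by move/sat_FDisj.
  move: tJ; rewrite tau_h /sat_some /= => tJ.
  by rewrite has_cat orbA [_ || has _ psis]psiE.
- have [psi [tau' [I' [tau_h [[cI' I'psi] _] ->]]]] := moves_FSat gen_h hs.
  (* [I'] satisfies the top of [tau], so the old invariant makes it an improvement. By transitivity,
     whatever improves on [I'] still satisfies the old [delta]. *)
  have I'_better : better_than GO I' (current h).(cur).
    have [_ [+ _]] := hP I' cI'; apply; rewrite tau_h.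
    by apply/orP; left; apply/asboolP.
  have dP J : consistent GO J ->
      sat J (FAnd (delta (current h)) (better I')) <-> better_than GO J I'.
    move=> cJ; have [dJ _] := hP J cJ; split=> [[_ /betterP]|JI']; first exact.
    split; last exact/betterP.
    by apply/dJ; apply: better_than_trans I'_better.
  split=> //= J cJ; split; first exact: dP.
  by rewrite /sat_some /= orbF -dP //; split=> [/asboolP|/asboolP].
- have [psi [tau' [tau_h unsat ->]]] := moves_FClose hs.
  split=> //= J cJ; have [dJ tJ] := hP J cJ.
  have nJ : ~ sat J psi by move=> Jpsi; apply: unsat; exists J.
  split; first by rewrite -dJ; split=> [[]|].
  by rewrite -tJ tau_h /sat_some /= (asboolF nJ).
Qed.

Lemma generated_invariant (h : history T) :
  generated S h -> state_invariant (current h).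
Proof.
elim=> [s /initial_state_invariant //|{}h r s gen_h inv_h hs].
by rewrite current_extend; apply: moves_invariant gen_h hs inv_h.
Qed.

(** The first F-Sat optimizes over [delta] and leaves its conjunction with [better I] as the only
    branch. A second answer [I'] would lie in the first branch too and beat its optimum [I]. *)
Lemma no_FSat_after_FSat_singleton (h : history T) (s s' : state T) :
  generated S h -> tau (current h) = [:: delta (current h)] ->
  moves S h FSat s -> ~ moves S (extend h FSat s) FSat s'.
Proof.
move=> gen_h tau_h hs hs'; have gen_s := GenS gen_h hs.
have [psi [tau' [I [tau_psi [I_sat I_opt] sE]]]] := moves_FSat gen_h hs.
have [psi' [tau'' [I' [+ [[cI' I'psi'] _] _]]]] := moves_FSat gen_s hs'.
move: tau_psi; rewrite tau_h current_extend sE => -[psiE _] -[psi'E _].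
move: I'psi'; rewrite -psi'E => -[I'delta I'better].
have [cI _] := I_sat.
have [_ _ I'I] : better_than GO I' I by apply/betterP.
by apply: I_opt; exists I' => //; rewrite -psiE.
Qed.

Lemma infinite_run_moves (s : state T) (u : nat -> rule * state T) :
  generates S (InfRun s u) ->
  forall n, moves S (History s (mkseq u n)) (u n).1 (u n).2.
Proof.
move=> gen_u n; have := gen_u n.+1.
have mkS : mkseq u n.+1 = rcons (mkseq u n) (u n) by rewrite -mkseqS.
(* Generalizing the history allows inversion of [generated]: sizes exclude [Gen0], and [rcons_inj]
   identifies the last move. *)
move E: (History s _) => h gen_h; case: gen_h E => [s1 _|h1 r s1 _ hs] /=.
  by rewrite mkS => -[_ /(congr1 size)]; rewrite size_rcons.
case: h1 hs => s0 l hs; rewrite /extend /= mkS => -[-> /rcons_inj [-> ->]].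
exact: hs.
Qed.

Lemma infinite_run_splits (s : state T) (u : nat -> rule * state T) :
  generates S (InfRun s u) -> ~ finitely_many_splits (InfRun s u).
Proof.
move=> gen_u [N no_split].
pose h n := History s (mkseq u n).
have hS n : h n.+1 = extend (h n) (u n).1 (u n).2.
  by rewrite /h /extend /= -surjective_pairing -mkseqS.
have mv n : moves S (h n) (u n).1 (u n).2 := infinite_run_moves gen_u n.
have curS n : current (h n.+1) = (u n).2 by rewrite hS current_extend.
have [n [Nn usat]] : exists n, N <= n /\ (u n).1 = FSat.
  apply: contrapT => no_sat.
  (* Without F-Split and F-Sat, each move from [N] on is an F-Close and removes exactly one
     formula. *)
  have sizeE k : size (tau (current (h (N + k)))) + k = size (tau (current (h N))).
    elim: k => [|k <-]; first by rewrite !addn0.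
    have Nk : N <= N + k := leq_addr k N.
    have := mv (N + k); case ur: (u (N + k)).1.
    - by have := no_split _ Nk.
    - by case: no_sat; exists (N + k).
    - move=> /moves_FClose[psi [tau' [tau_h _ sE]]].
      by rewrite [N + _]addnS curS sE tau_h /= addSnnS.
  have := sizeE (size (tau (current (h N)))).+1.
  by move/eqP; rewrite gtn_eqF // addnS ltnS leq_addl.
have sat_next m : N <= m -> (u m).1 = FSat ->
    tau (current (h m.+1)) = [:: delta (current (h m.+1))] /\ (u m.+1).1 = FSat.
  move=> Nm um; have := mv m; rewrite um.
  move=> /(moves_FSat (gen_u m))[psi [tau' [I' [_ _ sE]]]].
  have tauE : tau (current (h m.+1)) = [:: delta (current (h m.+1))].
    by rewrite curS sE.
  split=> //; have := mv m.+1; case ur: (u m.+1).1 => //.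
    by have := no_split _ (leqW Nm).
  move=> /moves_FClose[psi1 [tau1 [+ _ sE1]]]; rewrite tauE => -[_ tau1E].
  have tau0 : tau (current (h m.+2)) = [::] by rewrite curS sE1.
  (* The infinite run moves on from the emptied [tau], yet every rule needs a top formula. *)
  have [st _] := movesP (mv m.+2).
  by inversion st as [? ? ? ? tau2|? ? ? tau2|? ? tau2]; rewrite tau0 in tau2.
(* The F-Sat at [n] only brings [tau] to the form [[:: delta]]; the contradiction comes from those
   at [n.+1] and [n.+2]. *)
have [tau1 u1] := sat_next n Nn usat.
have [_ u2] := sat_next n.+1 (leqW Nn) u1.
have := mv n.+2; rewrite hS u1 u2.
by apply: no_FSat_after_FSat_singleton tau1 _; [exact: gen_u|rewrite -u1].
Qed.

End Calculus.

Theorem theorem4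
  (Sg : signature) (X V : sigsort Sg -> Type)
  (X_infinite : infinite_set [set: {s : sigsort Sg & X s}])
  (T : theory X V) (GO : gomt T)
  (solve : formula X -> option (tinterp T))
  (optimize : formula X -> term X (gsort GO) -> option (tinterp T))
  (better : tinterp T -> formula X)
  (solveP : solve_spec solve)
  (optimizeP : optimize_spec optimize)
  (betterP : better_spec GO better)
  (phi_sat : satisfiable T (constr GO))
  (has_optimum : exists I, optimal GO I)
  (S : hybrid_strategy solve optimize better)
  (S_bounded : not_unbounded S)
  (S_progressive : progressive S)
  (d : derivation T) (Sd : generates S d) :
  exists s : state T,
    [/\ ends_with d s,
        saturated GO solve better (fun chi => optimize chi (obj GO)) s &
        optimal GO (cur s)].
Proof.
have [halts_sat splits] := S_progressive.
case: d Sd => [h [gen_h halt_h]|s u gen_u]; last first.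
  have no_fin := infinite_run_splits solveP optimizeP betterP S_bounded gen_u.
  by case: (no_fin (splits _ gen_u)).
have sat_h := halts_sat h gen_h halt_h.
exists (current h); split=> //; apply: state_invariant_nil_optimal.
- exact: (generated_invariant solveP optimizeP betterP S_bounded gen_h).
- exact: saturated_nil sat_h.
Qed.
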